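(* Let $X$ be a metric space and $f:X\to X$ a continuous surjective map. If $(X,f)$ is positively expansive and has the shadowing property, then $(X,f)$ has the asymptotic shadowing property.
   Context: Let $\omega=\{0,1,2,\dots\}$. $X$ is not assumed compact. $(X,f)$ is positively expansive if there is a constant $c>0$ such that whenever $x,y\in X$ satisfy $d(f^n(x),f^n(y))<c$ for all $n\in\omega$, then $x=y$. For $\delta>0$, a $\delta$-pseudo-orbit is a sequence $\langle x_i\rangle_{i\in\omega}$ in $X$ with $d(f(x_i),x_{i+1})<\delta$ for all $i$; an asymptotic pseudo-orbit is a sequence in $X$ with $d(f(x_i),x_{i+1})\to0$ as $i\to\infty$. $(X,f)$ has the shadowing property if for all $\epsilon>0$ there exists $\delta>0$ such that for every $\delta$-pseudo-orbit $\langle x_i\rangle$ there is $z\in X$ with $d(f^i(z),x_i)<\epsilon$ for all $i\in\omega$. $(X,f)$ has the asymptotic shadowing property if for every asymptotic pseudo-orbit $\langle x_i\rangle$ there is $z\in X$ with $d(f^i(z),x_i)\to0$ as $i\to\infty$. *)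

(* Defs.v *)
From mathcomp Require Import all_boot all_order all_algebra.
From mathcomp Require Import all_classical all_reals all_analysis.

Set Implicit Arguments.
Unset Strict Implicit.
Unset Printing Implicit Defensive.

Import Order.TTheory GRing.Theory Num.Theory.
Import numFieldNormedType.Exports.

Local Open Scope classical_set_scope.
Local Open Scope ring_scope.

Definition positively_expansive (R : realType) (X : metricType R) (f : X -> X) : Prop :=
  exists2 c : R, 0 < c &
    forall x y : X, (forall n, mdist (iter n f x) (iter n f y) < c) -> x = y.

Definition pseudo_orbit (R : realType) (X : metricType R) (f : X -> X) (delta : R)
    (x : nat -> X) : Prop :=
  forall i, mdist (f (x i)) (x i.+1) < delta.

Definition asymptotic_pseudo_orbit (R : realType) (X : metricType R) (f : X -> X)
    (x : nat -> X) : Prop :=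
  mdist (f (x i)) (x i.+1) @[i --> \oo] --> (0 : R).

Definition shadowing_property (R : realType) (X : metricType R) (f : X -> X) : Prop :=
  forall eps : R, 0 < eps ->
    exists2 delta : R, 0 < delta &
      forall x : nat -> X, pseudo_orbit f delta x ->
        exists z : X, forall i, mdist (iter i f z) (x i) < eps.

Definition asymptotic_shadowing_property (R : realType) (X : metricType R)
    (f : X -> X) : Prop :=
  forall x : nat -> X, asymptotic_pseudo_orbit f x ->
    exists z : X, mdist (iter i f z) (x i) @[i --> \oo] --> (0 : R).

(* Main.v *)
(** Let [c] be an expansivity constant. By shadowing and surjectivity some [z] has
    an orbit that is eventually [c/2]-close to the asymptotic pseudo-orbit [x].
    Given [eps <= c/2], a tail of [x] starting at some [N] is [eps]-shadowed by a
    point [w]; the orbits of [w] and of [f^N z] then stay within [c] of each other,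
    so [w = f^N z] by expansivity, and the orbit of [z] is eventually [eps]-close
    to [x]. *)

Require Import Defs.
From mathcomp Require Import all_boot all_order all_algebra.
From mathcomp Require Import all_classical all_reals all_analysis.

Set Implicit Arguments.
Unset Strict Implicit.
Unset Printing Implicit Defensive.

Import Order.TTheory GRing.Theory Num.Theory.
Import numFieldNormedType.Exports.

Local Open Scope classical_set_scope.
Local Open Scope ring_scope.

Lemma iter_surj (T : Type) (f : T -> T) (n : nat) (y : T) :
  set_surj [set: T] [set: T] f -> exists x, iter n f x = y.
Proof.
move=> f_surj; elim: n y => [|n IHn] y; first by exists y.
have [u _ <-] := f_surj y I.
by have [x <-] := IHn u; exists x.
Qed.

Lemma shadow_tails (R : realType) (X : metricType R) (f : X -> X) (x : nat -> X)
    (eps : R) :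
  shadowing_property f -> asymptotic_pseudo_orbit f x -> 0 < eps ->
  exists N, forall n, (N <= n)%N ->
    exists z, forall i, mdist (iter i f z) (x (n + i)%N) < eps.
Proof.
move=> f_shad x_asym eps_gt0.
have [delta delta_gt0 shad] := f_shad _ eps_gt0.
have /cvgrPdist_lt /(_ _ delta_gt0) [N _ xN] := x_asym.
exists N => n leNn; apply: (shad (fun i => x (n + i)%N)) => i.
rewrite addnS; apply: le_lt_trans (xN (n + i)%N (leq_trans leNn (leq_addr _ _))).
by rewrite sub0r normrN ler_norm.
Qed.

Theorem theorem12 (R : realType) (X : metricType R) (f : X -> X)
    (f_cont : continuous f) (f_surj : set_surj [set: X] [set: X] f)
    (f_exp : positively_expansive f) (f_shad : shadowing_property f) :
  asymptotic_shadowing_property f.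
Proof.
move=> x x_asym; have [c c_gt0 expansive] := f_exp.
have c2_gt0 : 0 < c / 2 by rewrite divr_gt0.
have [N0 /(_ N0 (leqnn _)) [z0 z0P]] := shadow_tails f_shad x_asym c2_gt0.
have [z zE] := iter_surj N0 z0 f_surj.
exists z; apply/cvgrPdist_lt => eps eps_gt0.
have eps'_gt0 : 0 < Num.min eps (c / 2) by rewrite lt_min eps_gt0.
have [N1 tails] := shadow_tails f_shad x_asym eps'_gt0.
pose N := maxn N0 N1.
have [w wP] := tails N (leq_maxr _ _).
have wE : w = iter N f z.
  apply: expansive => n.
  have zP : mdist (iter n f (iter N f z)) (x (N + n)%N) < c / 2.
    rewrite -(subnK (leq_maxl N0 N1 : (N0 <= N)%N)) iterD zE -iterD.
    by rewrite addnAC addnC (addnC _ N0); exact: z0P.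
  have := wP n; rewrite lt_min => /andP[_ wc].
  rewrite [c]splitr; apply: le_lt_trans (ltrD wc zP).
  by rewrite (metric_sym (iter n f (iter N f z))); exact: metric_triangle.
exists N => // i /= leNi.
rewrite sub0r normrN ger0_norm ?mdist_ge0 //.
have := wP (i - N)%N; rewrite wE -iterD subnK // subnKC // lt_min.
by case/andP.
Qed.
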